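(* Let $E(x)$ denote the number of elite primes $p \le x$. Then $E(x) = O\left(\frac{x}{(\log x)^{3/2}}\right)$ as $x \to \infty$.
   Context: For $n \ge 0$ the $n$-th Fermat number is $F_n = 2^{2^n}+1$. A prime $p$ is called an elite prime if there exists $N$ such that $F_n$ is a quadratic nonresidue modulo $p$ for all $n \ge N$. *)

(* Defs.v *)
From mathcomp Require Import all_boot all_order all_algebra.
From mathcomp Require Import all_classical all_reals all_analysis.

Set Implicit Arguments.
Unset Strict Implicit.
Unset Printing Implicit Defensive.

Import Order.TTheory GRing.Theory Num.Theory.

Local Open Scope ring_scope.

Definition fermat (n : nat) : nat := (2 ^ (2 ^ n) + 1)%N.

Definition quadratic_nonresidue (p a : nat) : Prop :=
  coprime a p /\ ~ (exists y : nat, y ^ 2 = a %[mod p])%N.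

Definition elite_prime (p : nat) : Prop :=
  prime p /\
  exists N : nat, forall n : nat, (N <= n)%N ->
    quadratic_nonresidue p (fermat n).

(* For x >= 0, the naturals p <= x are exactly those with
   p < (Num.truncn x).+1; for x < 0, Num.truncn x = 0 and the only
   candidate is 0, which is not prime. *)
Definition elite_count (R : realType) (x : R) : nat :=
  count (fun p => `[< elite_prime p >]) (iota 0 (Num.truncn x).+1).

(* The library declares no such structure at +oo; without it the Landau
   notation f =O_ (+oo_R) g does not typecheck. *)
Canonical pinfty_nbhs_filter_on (R : numFieldType) : filter_on R :=
  FilterType (pinfty_nbhs R) (@filter_filter R _ proper_pinfty_nbhs).

(* Main.v *)
Require Import Defs.
From mathcomp Require Import all_boot all_order all_algebra.
From mathcomp Require Import all_classical all_reals all_analysis.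
From mathcomp Require Import cyclic zify ring lra.
Import Order.TTheory GRing.Theory Num.Theory numFieldNormedType.Exports.

Set Implicit Arguments.
Unset Strict Implicit.
Unset Printing Implicit Defensive.

(* Fix n >= 1 with 4 ^ n of the order of log x.  Writing p - 1 = 2 ^ e * k with
   k odd, the sequence F_j mod p is periodic from j = e on.  Hence an elite prime
   p is either 1 modulo 2 ^ n, or F_j is a nonresidue modulo p for all
   n <= j < 2 n.  In the second case reciprocity says that p has sign -1 modulo
   each F_j; as the F_j are pairwise coprime, p lies in a proportion at most
   2 ^ -n of the residue classes modulo M = F_n ... F_(2n-1) < 2 ^ (4 ^ n).
   For q = 2 ^ n or q = M, Selberg's sieve bounds the number of primes up to x in
   a residue class modulo q by O(x / (q log x)), the factor q / phi(q) being
   bounded because the prime divisors of F_j exceed 2 ^ (j + 1).  Both cases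
   contribute O(x / (2 ^ n log x)) = O(x / (log x) ^ (3 / 2)). *)

(** * Reciprocity for the sign of Gauss's lemma *)

(* The sign of Gauss's lemma for an arbitrary odd modulus (for [a] coprime to [n],
   the Jacobi symbol), with [true] for -1. *)
Definition gauss_sign (a n : nat) : bool :=
  \big[addb/false]_(1 <= k < n./2.+1) (n./2 < (a * k) %% n).

(** For odd [n], the absolute least residue: the distance from [x] to the nearest multiple of
    [n]. *)
Definition absmod (n x : nat) : nat :=
  if n./2 < x %% n then n - x %% n else x %% n.

(** Equal values at [k] and [l] force b k = ± b l modulo [n], so [n] divides the difference or the
    sum of [k] and [l]; for indices in [1, n/2] only k = l remains. Injectivity and equal sizes give
    the permutation. *)
Lemma absmod_perm (n b : nat) : odd n -> coprime b n ->
  perm_eq [seq absmod n (b * k) | k <- index_iota 1 n./2.+1]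
          (index_iota 1 n./2.+1).
Proof.
move=> on cbn; have n0 : 0 < n by case: n on {cbn}.
have nE : n = n./2.*2.+1 by rewrite -[LHS]odd_double_half on.
have cnb : coprime n b by rewrite coprime_sym.
have injb : {in index_iota 1 n./2.+1 &, injective (fun k => absmod n (b * k))}.
  have wlg k l : 0 < k -> k <= l -> l <= n./2 ->
      absmod n (b * k) = absmod n (b * l) -> k = l.
    move=> k0 kl lh; rewrite /absmod => e.
    have : (b * k) %% n = (b * l) %% n \/ (b * k) %% n + (b * l) %% n = n.
      have := ltn_pmod (b * k) n0; have := ltn_pmod (b * l) n0.
      by move: e; case: ifP => _; case: ifP => _; lia.
    case=> {}e.
      have : n %| b * l - b * k by rewrite -eqn_mod_dvd ?leq_mul2l ?kl ?orbT // e.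
      rewrite -mulnBr Gauss_dvdr // => /dvdnP[[|c]]; lia.
    have : n %| b * k + b * l by rewrite /dvdn -modnDm e modnn.
    rewrite -mulnDr Gauss_dvdr // => /dvdnP[[|c]]; lia.
  move=> k l; rewrite !mem_index_iota !ltnS => /andP[k0 kh] /andP[l0 lh] /= e.
  by case: (leqP k l) => [kl|/ltnW lk]; [|apply: esym]; apply: wlg.
have uq : uniq [seq absmod n (b * k) | k <- index_iota 1 n./2.+1].
  by rewrite map_inj_in_uniq // iota_uniq.
have sub : {subset [seq absmod n (b * k) | k <- index_iota 1 n./2.+1]
              <= index_iota 1 n./2.+1}.
  move=> _ /mapP[k kin ->]; move: kin; rewrite !mem_index_iota !ltnS /absmod.
  move=> /andP[k0 kh]; have m0 : 0 < (b * k) %% n.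
    rewrite lt0n; apply/negP=> nbk.
    have : n %| b * k by [].
    rewrite Gauss_dvdr // => /dvdnP[[|c]]; lia.
  by have := ltn_pmod (b * k) n0; case: ifP => ?; lia.
have [_ eqi] := uniq_min_size uq sub (eq_leq (esym (size_map _ _))).
by apply: uniq_perm => //; apply: iota_uniq.
Qed.

Lemma gauss_sign_modl (a n : nat) : gauss_sign (a %% n) n = gauss_sign a n.
Proof. by apply: eq_bigr => k _; rewrite modnMml. Qed.

(** The sum for [a] is reindexed along the permutation k -> [absmod n (b * k)]. Where r = b k mod n
    is replaced by n - r, the residue of a r is negated and changes halves, which is the term of
    [b]. *)
Lemma gauss_signM (a b n : nat) : odd n -> coprime a n -> coprime b n ->
  gauss_sign (a * b) n = gauss_sign a n (+) gauss_sign b n.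
Proof.
move=> on can cbn; have n0 : 0 < n by case: n on {can cbn}.
rewrite {2}/gauss_sign -(perm_big _ (absmod_perm on cbn)) big_map /=.
rewrite -big_split /=; apply: eq_big_seq => k.
rewrite mem_index_iota ltnS => /andP[k0 kh].
have nE : n = n./2.*2.+1 by rewrite -[LHS]odd_double_half on.
rewrite /absmod -mulnA -modnMmr; set r := (b * k) %% n.
have rn : r < n by rewrite ltn_pmod.
have r0 : 0 < r.
  rewrite lt0n; apply/negP=> nbk.
  have : n %| b * k by [].
  rewrite Gauss_dvdr 1?coprime_sym // => /dvdnP[[|c]]; lia.
case: (ltnP n./2 r) => hr; last by rewrite addbF.
have s0 : 0 < (a * r) %% n.
  rewrite lt0n; apply/negP=> nbk.
  have : n %| a * r by [].
  rewrite Gauss_dvdr 1?coprime_sym // => /dvdnP[[|c]]; lia.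
have sn : (a * r) %% n < n by rewrite ltn_pmod.
have : n %| (a * r) %% n + (a * (n - r)) %% n.
  by rewrite /dvdn modnDm -mulnDr subnKC ?modnMl // ltnW.
have : (a * (n - r)) %% n < n by rewrite ltn_pmod.
move: (_ %% n) => t tn /dvdnP[[|[|c]]]; last by nia.
  by lia.
by rewrite mul1n addbT; case: ltnP; case: ltnP => /=; lia.
Qed.

(* Eisenstein's parity argument: [a k = n (a k %/ n) + r], and [r] is up to
   sign the [k]-th term of a permutation of [1 .. n./2]. *)
Lemma gauss_sign_floor (a n : nat) : odd a -> odd n -> coprime a n ->
  gauss_sign a n = odd (\sum_(1 <= k < n./2.+1) (a * k) %/ n).
Proof.
move=> oa on can.
have S : \big[addb/false]_(1 <= k < n./2.+1) odd k =
         \big[addb/false]_(1 <= k < n./2.+1) odd (absmod n (a * k)).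
  by rewrite -(perm_big _ (absmod_perm on can)) big_map.
rewrite (big_morph odd oddD (erefl _)).
rewrite -[RHS]addbF -(addbb (\big[addb/false]_(1 <= k < n./2.+1) odd k)) {2}S.
rewrite -!big_split /=; apply: eq_bigr => k _.
have n0 : 0 < n by case: n on {can S}.
have := congr1 odd (divn_eq (a * k) n).
rewrite oddD !oddM oa on andbT /= /absmod.
have := ltn_pmod (a * k) n0.
case: ifP => h rn ->; last by rewrite -!addbA addbb addbF addbb.
by rewrite oddB ?(ltnW rn) // on; do 2!case: odd.
Qed.

(** Eisenstein's lattice count: the two floor sums count the points of the a/2 by n/2 rectangle on
    either side of the line n l = a k, and coprimality keeps the line itself free of points. *)
Lemma gauss_sign_reciprocity (a n : nat) : odd a -> odd n -> coprime a n ->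
  gauss_sign a n (+) gauss_sign n a = odd (a./2 * n./2).
Proof.
move=> oa on can.
(* The floor of b k / m counts the l >= 1 with m l < b k, and it does not exceed b/2 since k <= m/2,
   so [l] may be confined to the rectangle. *)
have F (b m : nat) : odd b -> odd m -> coprime b m ->
    \sum_(1 <= k < m./2.+1) (b * k) %/ m =
    \sum_(1 <= k < m./2.+1) \sum_(1 <= l < b./2.+1) (m * l < b * k).
  move=> ob om cbm; rewrite big_nat [RHS]big_nat; apply: eq_bigr => k /andP[k0 kh].
  have bE : b = b./2.*2.+1 by rewrite -[LHS]odd_double_half ob.
  have mE : m = m./2.*2.+1 by rewrite -[LHS]odd_double_half om.
  have m0 : 0 < m by lia.
  have neq l : (m * l < b * k) = (l <= (b * k) %/ m).
    rewrite leq_divRL // mulnC ltn_neqAle; case: eqP => //= e.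
    have : m %| b * k by rewrite -e dvdn_mull.
    rewrite Gauss_dvdr 1?coprime_sym // => /dvdnP[[|c]]; lia.
  have qb : (b * k) %/ m <= b./2.
    rewrite -ltnS ltn_divLR //; nia.
  under [RHS]eq_bigr do rewrite neq.
  have Q : (b * k) %/ m = \sum_(1 <= l < ((b * k) %/ m).+1) 1.
    by rewrite sum_nat_const_nat muln1 subn1.
  rewrite [LHS]Q (@big_cat_nat _ _ _ ((b * k) %/ m).+1 1 b./2.+1) //=.
  rewrite [X in _ = _ + X]big_nat [X in _ = _ + X]big1 ?addn0.
    by apply: eq_big_nat => l /andP[_]; rewrite ltnS => ->.
  by move=> l; rewrite ltnNge => /andP[/negbTE ->].
have cna : coprime n a by rewrite coprime_sym.
rewrite !gauss_sign_floor // -oddD !F // [X in odd (_ + X)]exchange_big /= -big_split /=.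
congr (odd _); transitivity (\sum_(1 <= k < n./2.+1) a./2); last first.
  by rewrite sum_nat_const_nat mulnC; lia.
rewrite big_nat [RHS]big_nat; apply: eq_bigr => k /andP[k0 kh]; rewrite -big_split /=.
transitivity (\sum_(1 <= l < a./2.+1) 1); last by rewrite sum_nat_const_nat; lia.
rewrite big_nat [RHS]big_nat; apply: eq_bigr => l /andP[l0 lh].
case: ltngtP => //= e.
have : n %| a * k by rewrite -e dvdn_mulr.
rewrite Gauss_dvdr // => /dvdnP[[|c]]; have := odd_double_half n; lia.
Qed.

(** * Euler's criterion and Gauss's lemma modulo an odd prime *)

Section EulerCriterion.
Variable p : nat.
Hypotheses (p_prime : prime p) (p_odd : odd p).
Local Open Scope ring_scope.

Lemma eqFp_nat (x y : nat) :
  (x%:R == y%:R :> 'F_p) = (x == y %[mod p]).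
Proof. by rewrite -val_eqE /= !val_Fp_nat. Qed.

Lemma Fp_nat_neq0 (x : nat) : coprime x p -> x%:R != 0 :> 'F_p.
Proof.
by rewrite -(dvdn_pcharf (pchar_Fp p_prime)) -prime_coprime // coprime_sym.
Qed.

Lemma lt_coprime_prime (k : nat) : (0 < k < p)%N -> coprime k p.
Proof.
move=> /andP[k0 kp]; rewrite coprime_sym prime_coprime //.
by apply/negP => /(dvdn_leq k0); rewrite leqNgt kp.
Qed.

(** The squares of 1, ..., p/2 are p/2 distinct roots of X^(p/2) - 1; a further root [a] would
    exceed the degree. *)
Lemma Euler_criterion_sqr (a : nat) :
  (a%:R : 'F_p) ^+ p./2 = 1 -> exists y : nat, (y ^ 2 = a %[mod p])%N.
Proof.
move=> ah; have pE := odd_double_half p; rewrite p_odd in pE.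
have p1 := prime_gt1 p_prime.
have h0 : (0 < p./2)%N by lia.
set q := [seq (k ^ 2)%:R | k <- index_iota 1 p./2.+1] : seq 'F_p.
have [/mapP[k _ /eqP]|aq] := boolP (a%:R \in q).
  by rewrite eqFp_nat => /eqP ak; exists k.
have : (size (a%:R :: q) < size ('X^(p./2) - 1%:P : {poly 'F_p})%R)%N.
  apply: max_poly_roots.
  - by rewrite -size_poly_eq0 size_XnsubC.
  - apply/allP => x /predU1P[->|/mapP[k]]; first by rewrite rootE !hornerE ah subrr.
    rewrite mem_index_iota => /andP[k0 kh] ->.
    have ck : coprime k p by apply: lt_coprime_prime; lia.
    rewrite rootE !hornerE subr_eq0 -natrX -expnM mul2n -[1]/(1%:R) eqFp_nat.
    have -> : p./2.*2 = totient p by rewrite totient_prime //; lia.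
    by rewrite Euler_exp_totient.
  - rewrite /= aq map_inj_in_uniq ?iota_uniq // => k l.
    rewrite !mem_index_iota => /andP[k0 kh] /andP[l0 lh] /eqP.
    rewrite !natrX -subr_eq0 subr_sqr mulf_eq0 subr_eq0 eqFp_nat -natrD.
    rewrite -(dvdn_pcharf (pchar_Fp p_prime)) => /orP[|/dvdn_leq]; last by lia.
    by rewrite !modn_small; [move/eqP|lia..].
by rewrite size_XnsubC //= size_map size_iota; lia.
Qed.

(** The product of the a k for k <= p/2 is a^(p/2) f on one hand and, by signed least residues,
    (-1)^[gauss_sign a p] f on the other, with [f] invertible. Euler's criterion then applies. *)
Lemma Gauss_lemma_sqr (a : nat) : coprime a p -> gauss_sign a p = false ->
  exists y : nat, (y ^ 2 = a %[mod p])%N.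
Proof.
move=> cap sa; apply: Euler_criterion_sqr.
have pE := odd_double_half p; rewrite p_odd in pE.
have p0 := prime_gt0 p_prime.
pose f := \prod_(1 <= k < p./2.+1) k%:R : 'F_p.
have f0 : f != 0.
  rewrite prodf_seq_neq0; apply/allP => k; rewrite mem_index_iota => kh.
  by apply/implyP => _; apply/Fp_nat_neq0/lt_coprime_prime; lia.
apply: (mulIf f0); rewrite mul1r.
transitivity (\prod_(1 <= k < p./2.+1) ((a * k)%:R : 'F_p)).
  under [RHS]eq_bigr do rewrite natrM.
  by rewrite big_split /= prodr_const_nat subn1.
transitivity (\prod_(1 <= k < p./2.+1) ((-1) ^+ (p./2 < (a * k) %% p)%N *
    (absmod p (a * k))%:R : 'F_p)).
  apply: eq_bigr => k _; rewrite -[in LHS]Fp_nat_mod // /absmod.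
  case: ltnP => h; last by rewrite mul1r.
  rewrite expr1 mulN1r natrB ?(ltnW (ltn_pmod _ _)) //.
  by rewrite opprB pchar_Fp_0 // subr0.
rewrite big_split /=.
suff -> : \prod_(1 <= k < p./2.+1) (-1) ^+ (p./2 < (a * k) %% p)%N =
   (-1) ^+ gauss_sign a p :> 'F_p.
  by rewrite sa mul1r /f -[RHS](perm_big _ (absmod_perm p_odd cap)) big_map.
rewrite (@big_morph _ _ (fun b : bool => (-1) ^+ b : 'F_p) 1 *%R false addb) //.
exact: signr_addb.
Qed.

End EulerCriterion.

Lemma leq_size_inj (T : eqType) (T' : eqType) (f : T -> T') (s : seq T) (t : seq T') :
  uniq s -> {in s &, injective f} -> (forall x, x \in s -> f x \in t) ->
  size s <= size t.
Proof.
move=> us fi st; rewrite -(size_map f) uniq_leq_size ?map_inj_in_uniq //.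
by move=> _ /mapP[x xs ->]; apply: st.
Qed.

(** For odd [n], Jacobi symbol -1; the coprimality test discards the residues of symbol 0. *)
Definition gauss_minus (n r : nat) : bool := coprime r n && gauss_sign r n.

(* Multiplication by one element of sign -1 maps the elements of sign -1
   injectively into those of sign +1. *)
Lemma count_gauss_minus (n : nat) : odd n ->
  2 * count (gauss_minus n) (iota 0 n) <= n.
Proof.
move=> on; have n0 : 0 < n by case: n on.
rewrite -[X in _ <= X](size_iota 0) -(count_predC (gauss_minus n)) mul2n -addnn.
rewrite leq_add2l -!size_filter.
case E: [seq _ <- _ | _] => [//|b s].
have : b \in [seq r <- iota 0 n | gauss_minus n r] by rewrite E mem_head.
rewrite -{s}E mem_filter => /andP[/andP[cb sb] _].
apply: (@leq_size_inj _ _ (fun r => (b * r) %% n)).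
- by rewrite filter_uniq ?iota_uniq.
- move=> r s; rewrite !mem_filter !mem_iota !add0n => /andP[_ rn] /andP[_ sn].
  wlog rs : r s rn sn / r <= s.
    move=> W; case: (leqP r s) => [|/ltnW] rs e; first exact: W.
    by apply/esym/W.
  move/esym/eqP; rewrite eqn_mod_dvd ?leq_mul2l ?rs ?orbT // -mulnBr.
  rewrite Gauss_dvdr 1?coprime_sym // => /dvdnP[[|c]]; lia.
move=> r; rewrite !mem_filter !mem_iota /= add0n => /andP[/andP[cr sr] rn].
rewrite ltn_pmod // andbT /gauss_minus gauss_sign_modl gauss_signM // sb sr.
by rewrite andbF.
Qed.

(** * Selberg's sieve in arithmetic progressions *)

Lemma sum_dvdn_progression_period (a q V : nat) : 0 < V -> coprime V q ->
  \sum_(0 <= k < V) (V %| a + q * k) = 1.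
Proof.
move=> V0 cVq.
have [k kV ak] : exists2 k, k < V & V %| a + q * k.
  have [q0|q0] := posnP q.
    by exists 0 => //; move: cVq; rewrite q0 /coprime gcdn0 => /eqP ->; rewrite dvd1n.
  (* A solution of x = 0 mod [V] and x = a mod [q], raised by a multiple of V q to reach at least
     [a], so that x - a is a natural multiple of [q]. *)
  pose x := chinese V q 0 a + V * q * a.
  have xa : a <= x.
    by rewrite (leq_trans _ (leq_addl _ _)) // leq_pmull // muln_gt0 V0.
  have : q %| x - a.
    by rewrite -eqn_mod_dvd // /x mulnAC addnC modnMDl chinese_modr.
  case/dvdnP => c xc; exists (c %% V); first by rewrite ltn_pmod.
  rewrite /dvdn -modnDmr modnMmr modnDmr mulnC -xc subnKC // /x -mulnA.
  by rewrite addnC mulnC modnMDl chinese_modl // mod0n.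
rewrite (bigD1_seq k) ?mem_index_iota ?iota_uniq //= ak big_nat_cond big1 //.
move=> l /andP[/andP[_ lV] lk]; apply/eqP; rewrite eqb0; apply/negP => al.
wlog kl : k l kV ak lV lk al / k < l.
  by move=> W; case: (ltngtP k l) lk => // kl lk; [apply: (W k l)|apply: (W l k)] => //; lia.
have : V %| (a + q * l) - (a + q * k) by rewrite dvdn_sub.
rewrite subnDl -mulnBr Gauss_dvdr // => /dvdn_leq; lia.
Qed.

(** Division-free form of: the count differs from K/V by at most 1. Full periods contribute exactly
    one each. *)
Lemma sum_dvdn_progression (a q V K : nat) : 0 < V -> coprime V q ->
  K <= (\sum_(0 <= k < K) (V %| a + q * k)).+1 * V /\
  (\sum_(0 <= k < K) (V %| a + q * k)) * V <= K + V.
Proof.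
move=> V0 cVq; have [n] := ubnP K; elim: n K => // n IH K Kn.
have [KV|VK] := ltnP K V.
  have : \sum_(0 <= k < K) (V %| a + q * k) <= 1.
    rewrite -(sum_dvdn_progression_period a V0 cVq).
    by rewrite [X in _ <= X](big_cat_nat (n := K)) ?leq_addr //= ltnW.
  by move: (\sum_(0 <= k < K) _) => c; nia.
have {}IH := IH (K - V); rewrite (big_cat_nat (n := V)) //=.
rewrite sum_dvdn_progression_period //.
have -> : \sum_(V <= k < K) (V %| a + q * k) =
          \sum_(0 <= k < K - V) (V %| a + q * k).
  rewrite -{1}[V]add0n big_addn; apply: eq_bigr => k _.
  by rewrite mulnDr addnA (dvdn_addl _ (dvdn_mull q (dvdnn V))).
move: (\sum_(0 <= k < K - V) _) IH => c; nia.
Qed.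

Local Open Scope ring_scope.

Section SelbergSieve.
Variables (R : realFieldType) (q z : nat).
Implicit Types A B C : {set 'I_z.+1}.

(* A set [A] of primes stands for the squarefree number [setprod A], so that
   [sphi A] is its totient and [sieve_weight A] Selberg's optimal weight. *)
Definition setprod A : nat := \prod_(i in A) i.

Definition sieving A : bool := [forall i in A, prime (i : nat) && coprime i q].

Definition sieve_dom A : bool := sieving A && (setprod A <= z)%N.

Definition sphi A : R := \prod_(i in A) (i%:R - 1).

(** Selberg's denominator: the sum of 1/phi(d) over squarefree d <= z coprime to [q]. *)
Definition sieve_mass : R := \sum_(A | sieve_dom A) (sphi A)^-1.

Definition sieve_weight A : R := (-1) ^+ #|A| * ((setprod A)%:R / sieve_mass) *
  \sum_(B | sieve_dom B && (A \subset B)) (sphi B)^-1.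

Lemma sieving_prime A i : sieving A -> i \in A -> prime (i : nat).
Proof. by move=> /forall_inP/(_ i) sA /sA/andP[]. Qed.

Lemma setprod_gt0 A : sieving A -> (0 < setprod A)%N.
Proof. by move=> sA; apply: prodn_cond_gt0 => i /(sieving_prime sA)/prime_gt0. Qed.

Lemma setprod0 : setprod finset.set0 = 1%N.
Proof. by rewrite /setprod big_set0. Qed.

Lemma setprodUI A B :
  (setprod (A :|: B) * setprod (A :&: B) = setprod A * setprod B)%N.
Proof.
rewrite /setprod !(big_mkcond (fun i => i \in _)) /= -!big_split /=.
apply: eq_bigr => i _; rewrite !inE.
by case: (i \in A); case: (i \in B); rewrite ?muln1 ?mul1n.
Qed.

Lemma setprod_dvd A n : sieving A ->
  (setprod A %| n)%N = [forall i in A, (i %| n)%N].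
Proof.
move=> sA; apply/idP/forall_inP => [dn i iA|].
  by apply: dvdn_trans dn; rewrite /setprod (bigD1 i) //= dvdn_mulr.
move=> dn; rewrite /setprod -big_enum /=.
have : {subset enum A <= A} by move=> i; rewrite mem_enum.
elim: (enum A) (enum_uniq A) => [|i s IH] /=; first by rewrite big_nil dvd1n.
move=> /andP[is_ us] sub; rewrite big_cons Gauss_dvd.
  rewrite dn ?sub ?mem_head //= IH // => j js.
  by apply: sub; rewrite inE js orbT.
rewrite big_seq; apply: (big_ind (coprime i)) => [|x y cx cy|j js]; first exact: coprimen1.
  by rewrite coprimeMr cx.
rewrite prime_coprime ?dvdn_prime2 ?(sieving_prime sA) ?sub ?mem_head //.
  by apply: contraNneq is_ => /val_inj ->.
by rewrite inE js orbT.
Qed.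

Lemma coprime_setprod A : sieving A -> coprime (setprod A) q.
Proof.
move=> sA; apply: (big_ind (fun n => coprime n q)) => [|x y cx cy|i iA].
- exact: coprime1n.
- by rewrite coprimeMl cx.
by case/andP: (forall_inP sA i iA).
Qed.

Lemma sievingU A B : sieving A -> sieving B -> sieving (A :|: B).
Proof.
move=> sA sB.
by apply/forall_inP => i; rewrite inE => /orP[/(forall_inP sA)|/(forall_inP sB)].
Qed.

Lemma dvdn_setprodU A B n : sieving A -> sieving B ->
  (setprod (A :|: B) %| n)%N = (setprod A %| n)%N && (setprod B %| n)%N.
Proof.
move=> sA sB; have sAB := sievingU sA sB.
rewrite !setprod_dvd //; apply/forall_inP/andP => [d|[/forall_inP dA /forall_inP dB] i].
  by split; apply/forall_inP => i iA; apply: d; rewrite inE iA ?orbT.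
by rewrite inE => /orP[/dA|/dB].
Qed.

Lemma sieve_dom_sub A B : A \subset B -> sieve_dom B -> sieve_dom A.
Proof.
move=> AB /andP[sB pB]; have sA : sieving A.
  by apply/forall_inP => i /(fintype.subsetP AB)/(forall_inP sB).
rewrite /sieve_dom sA; apply: leq_trans pB; apply: dvdn_leq (setprod_gt0 sB) _.
rewrite setprod_dvd //; apply/forall_inP => i /(fintype.subsetP AB) iB.
by rewrite /setprod (bigD1 i) //= dvdn_mulr.
Qed.

Lemma sphi_gt0 A : sieving A -> 0 < sphi A.
Proof.
move=> sA; rewrite /sphi; apply: prodr_gt0 => i /(sieving_prime sA)/prime_gt1 i1.
by rewrite subr_gt0 ltr1n.
Qed.

Lemma sphi_inv_ge0 A : sieve_dom A -> 0 <= (sphi A)^-1.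
Proof. by case/andP=> sA _; rewrite invr_ge0 ltW ?sphi_gt0. Qed.

(** The identity that phi(d) summed over d | n is n, for squarefree n: expand the product of (i - 1)
    + 1. *)
Lemma sphi_sum A : \sum_(C : {set 'I_z.+1} | C \subset A) sphi C = (setprod A)%:R.
Proof.
rewrite /setprod natr_prod big_mkcond /=.
transitivity (\prod_i ((if i \in A then (i : nat)%:R - 1 else 0) + 1 : R)).
  rewrite bigA_distr /= big_mkcond /=; apply: eq_bigr => C _; case: ifP => CA.
    rewrite /sphi big_mkcond /=; apply: eq_bigr => i _; case: ifP => // iC.
    by rewrite (fintype.subsetP CA).
  have /subsetPn[i iC iA] := negbT CA.
  by rewrite (bigD1 i) //= iC (negbTE iA) mul0r.
rewrite [RHS]big_mkcond; apply: eq_bigr => i _; case: ifP => _; first by rewrite subrK.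
by rewrite add0r.
Qed.

(** Expanding a product over all indices, any [i] in [B] but not in [C] contributes the factor -1 +
    1 = 0. *)
Lemma sum_sign_interval B C : C \subset B ->
  \sum_(A : {set 'I_z.+1} | (C \subset A) && (A \subset B)) (-1) ^+ #|A| =
  if C == B then (-1) ^+ #|C| else 0 :> R.
Proof.
move=> CB.
transitivity (\prod_i ((if i \in B then -1 else 0) +
                       (if i \in C then 0 else 1)) : R).
  rewrite bigA_distr /= big_mkcond /=; apply: eq_bigr => A _.
  case: ifP => [/andP[CA AB]|].
    rewrite -(@prodr_const _ _ (mem A)) big_mkcond; apply: eq_bigr => i _.
    case: ifP => [iA|/negbT iA]; first by rewrite (fintype.subsetP AB).
    by rewrite (negbTE (contra (fintype.subsetP CA i) iA)).
  move=> /negbT; rewrite negb_and => /orP[]/subsetPn[i i1 i2]; rewrite (bigD1 i) //=.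
    by rewrite (negbTE i2) i1 mul0r.
  by rewrite i1 (negbTE i2) mul0r.
case: eqP => [->|/eqP nCB].
  rewrite -(@prodr_const _ _ (mem B)) [RHS]big_mkcond; apply: eq_bigr => i _.
  by case: ifP; rewrite ?addr0 ?add0r.
have /subsetPn[i iB iC] : ~~ (B \subset C) by rewrite finset.eqEsubset CB in nCB.
by rewrite (bigD1 i) //= iB (negbTE iC) addNr mul0r.
Qed.

(** * Size of the weights and value of the quadratic form *)

Hypothesis z_gt0 : (0 < z)%N.

Lemma sieve_dom0 : sieve_dom finset.set0.
Proof. by rewrite /sieve_dom setprod0 z_gt0 andbT; apply/forall_inP => i; rewrite inE. Qed.

Lemma sieve_mass_gt0 : 0 < sieve_mass.
Proof.
rewrite /sieve_mass (bigD1 finset.set0) ?sieve_dom0 //= ltr_pwDl //.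
  by rewrite /sphi big_set0 invr1.
by apply: sumr_ge0 => A /andP[dA _]; apply: sphi_inv_ge0.
Qed.

Lemma sieve_weight0 : sieve_weight finset.set0 = 1.
Proof.
rewrite /sieve_weight cards0 expr0 mul1r setprod0.
under eq_bigl do rewrite finset.sub0set andbT.
by rewrite -/sieve_mass mul1r mulVf // gt_eqF ?sieve_mass_gt0.
Qed.

(** A crude bound, from [setprod A] at most [z] and an inner sum that is part of [sieve_mass]; it
    suffices because [z] will be a small power of x. *)
Lemma norm_sieve_weight A : sieve_dom A -> `|sieve_weight A| <= z%:R.
Proof.
move=> dA; have L0 := sieve_mass_gt0.
have S0 : 0 <= \sum_(B | sieve_dom B && (A \subset B)) (sphi B)^-1.
  by apply: sumr_ge0 => B /andP[dB _]; apply: sphi_inv_ge0.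
have SL : \sum_(B | sieve_dom B && (A \subset B)) (sphi B)^-1 <= sieve_mass.
  rewrite /sieve_mass [leRHS](bigID (fun B : {set 'I_z.+1} => A \subset B)) /= lerDl.
  by apply: sumr_ge0 => B /andP[dB _]; apply: sphi_inv_ge0.
rewrite /sieve_weight !normrM normr_sign mul1r (ger0_norm S0) normfV.
rewrite (gtr0_norm L0) normr_nat -mulrA [X in _ * X]mulrC.
apply: le_trans (_ : (setprod A)%:R * 1 <= _).
  by rewrite ler_wpM2l // ler_pdivrMr // mul1r.
by rewrite mulr1 ler_nat; case/andP: dA.
Qed.

(* Moebius inversion over the down-closed family [sieve_dom]. *)
Lemma sieve_weight_inversion C : sieve_dom C ->
  \sum_(A | sieve_dom A && (C \subset A)) sieve_weight A / (setprod A)%:R =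
  (-1) ^+ #|C| / (sphi C * sieve_mass).
Proof.
move=> dC; have L0 := sieve_mass_gt0.
transitivity (\sum_(A | sieve_dom A && (C \subset A))
  \sum_(B | sieve_dom B) (if (C \subset B) && (A \subset B) then
    (-1) ^+ #|A| * ((sphi B)^-1 / sieve_mass) else 0)).
  apply: eq_bigr => A /andP[dA CA].
  have vA : (setprod A)%:R != 0 :> R.
    by rewrite pnatr_eq0 -lt0n setprod_gt0 //; case/andP: dA.
  rewrite /sieve_weight -big_mkcondr /= mulrAC.
  have -> : (-1) ^+ #|A| * ((setprod A)%:R / sieve_mass) / (setprod A)%:R =
      (-1) ^+ #|A| / sieve_mass by field; rewrite vA gt_eqF.
  rewrite mulr_sumr; apply: eq_big => [B|B _]; last by rewrite -mulrA [X in _ * X]mulrC.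
  by case: (boolP (A \subset B)) => [/(fintype.subset_trans CA) ->|]; rewrite !(andbT, andbF).
rewrite exchange_big /= (bigD1 C) //= [X in _ + X]big1 ?addr0.
  rewrite -big_mkcondr /= fintype.subxx /= (big_pred1 C) ?invfM // => A.
  rewrite /= finset.eqEsubset andbC; case: (boolP (A \subset C)) => AC //=.
  by rewrite (sieve_dom_sub AC dC).
move=> B /andP[dB BC]; rewrite -big_mkcondr /=.
have [CB|CB] := boolP (C \subset B); last by rewrite big_pred0 // => A; rewrite andbF.
rewrite -mulr_suml -[X in _ = X](mul0r ((sphi B)^-1 / sieve_mass)); congr (_ * _).
have S := sum_sign_interval CB; rewrite eq_sym (negbTE BC) in S; rewrite -[RHS]S.
apply: eq_bigl => A; case: (boolP (A \subset B)) => AB; rewrite !(andbT, andbF) //=.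
by rewrite (sieve_dom_sub AB dB).
Qed.

(** Diagonalisation: 1/lcm = gcd/(product), and the gcd is the sum of [sphi C] over common subsets.
    The form becomes a sum of [sphi C] times squares, each known from [sieve_weight_inversion]. *)
Lemma sieve_quadratic_form :
  \sum_(A | sieve_dom A) \sum_(B | sieve_dom B)
     sieve_weight A * sieve_weight B / (setprod (A :|: B))%:R = sieve_mass^-1.
Proof.
have L0 := sieve_mass_gt0.
transitivity (\sum_(A | sieve_dom A) \sum_(B | sieve_dom B) \sum_(C | sieve_dom C)
  sphi C * ((if C \subset A then sieve_weight A / (setprod A)%:R else 0) *
            (if C \subset B then sieve_weight B / (setprod B)%:R else 0))).
  apply: eq_bigr => A dA; apply: eq_bigr => B dB.
  have [sA sB] : sieving A /\ sieving B by case/andP: dA; case/andP: dB.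
  have vA : (setprod A)%:R != 0 :> R by rewrite pnatr_eq0 -lt0n setprod_gt0.
  have vB : (setprod B)%:R != 0 :> R by rewrite pnatr_eq0 -lt0n setprod_gt0.
  have UI : (setprod (A :|: B))%:R * (setprod (A :&: B))%:R =
      (setprod A)%:R * (setprod B)%:R :> R by rewrite -!natrM setprodUI.
  have vU : (setprod (A :|: B))%:R != 0 :> R.
    by apply: contraNneq vA => e; move/eqP: UI; rewrite e mul0r eq_sym mulf_eq0 (negbTE vB) orbF.
  have -> : sieve_weight A * sieve_weight B / (setprod (A :|: B))%:R =
     (setprod (A :&: B))%:R * (sieve_weight A / (setprod A)%:R *
         (sieve_weight B / (setprod B)%:R)).
    by apply: (mulfI vU); rewrite [RHS]mulrA UI; field; rewrite vA vB vU.
  rewrite -sphi_sum mulr_suml.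
  rewrite [LHS]big_mkcond [RHS]big_mkcond; apply: eq_bigr => C _ /=; rewrite finset.subsetI.
  case: (boolP (C \subset A)) => CA /=; last by rewrite mul0r mulr0 if_same.
  rewrite (sieve_dom_sub CA dA).
  by case: ifP => //; rewrite !mulr0.
transitivity (\sum_(C | sieve_dom C) sphi C *
  (\sum_(A | sieve_dom A && (C \subset A)) sieve_weight A / (setprod A)%:R) ^+ 2).
  under eq_bigr do rewrite exchange_big /=.
  rewrite exchange_big /=; apply: eq_bigr => C dC.
  rewrite expr2 [in RHS]big_mkcondr /= big_distrlr /= mulr_sumr; apply: eq_bigr => A _.
  by rewrite mulr_sumr.
transitivity (\sum_(C | sieve_dom C) (sphi C)^-1 * (sieve_mass ^+ 2)^-1).
  apply: eq_bigr => C dC; rewrite sieve_weight_inversion // expr_div_n sqrr_sign.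
  have p0 : sphi C != 0 by rewrite gt_eqF // sphi_gt0 //; case/andP: dC.
  by field; rewrite p0 gt_eqF.
by rewrite -mulr_suml -/sieve_mass; field; rewrite gt_eqF.
Qed.

(** By unique factorisation a set of primes is determined by its product, which is at most [z]. *)
Lemma card_sieve_dom : (#|[pred A | sieve_dom A]| <= z.+1)%N.
Proof.
rewrite -[X in (_ <= X)%N]card_ord.
apply: (@leq_card_in _ _ (fun A => inord (setprod A) : 'I_z.+1)) => A B.
rewrite !inE => /andP[sA pA] /andP[sB pB] /(congr1 val).
rewrite /= !inordK ?ltnS // => e.
have sub A' B' : sieving A' -> sieving B' -> setprod A' = setprod B' -> A' \subset B'.
  move=> sA' sB' e'; apply/fintype.subsetP => i iA.
  have pi := sieving_prime sA' iA.
  have : (i %| setprod B')%N by rewrite -e' /setprod (bigD1 i) //= dvdn_mulr.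
  rewrite /setprod Euclid_dvd_prod // big_has_cond => /hasP[j _ /andP[jB]].
  by rewrite (dvdn_prime2 pi (sieving_prime sB' jB)) => /eqP/val_inj ->.
by apply/eqP; rewrite finset.eqEsubset !sub.
Qed.

(** * The sieve inequality *)

Definition sieve_sum (n : nat) : R :=
  \sum_(A | sieve_dom A) sieve_weight A * (setprod A %| n)%:R.

Lemma sieve_sum_prime (n : nat) : prime n -> (z < n)%N -> sieve_sum n = 1.
Proof.
move=> pn zn; rewrite /sieve_sum (bigD1 finset.set0) ?sieve_dom0 //=.
rewrite sieve_weight0 setprod0 dvd1n mulr1 big1 ?addr0 // => A /andP[/andP[sA pA] A0].
have /finset.set0Pn[i iA] := A0.
have iv : (i %| setprod A)%N by rewrite /setprod (bigD1 i) //= dvdn_mulr.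
case: (boolP (setprod A %| n)%N) => [|_]; last by rewrite mulr0.
case/primeP: pn => _ pn /pn /orP[]/eqP e; last by lia.
by have := prime_gt1 (sieving_prime sA iA); move: iv; rewrite e dvdn1 => /eqP ->.
Qed.

(** The square of [sieve_sum] is nonnegative and equals 1 at primes above [z]. The three terms come
    from primes up to [z], from the quadratic form, and from the rounding errors in the counts. *)
Theorem Selberg_sieve_primes (a K : nat) : (0 < q)%N ->
  (\sum_(0 <= k < K) prime (a + q * k))%:R <=
  z.+1%:R + K%:R / sieve_mass + (z * z.+1)%:R ^+ 2.
Proof.
move=> q0.
(* As q > 0, a term a + q k <= z has k <= z, which leaves at most z + 1 such terms. *)
have small : (\sum_(0 <= k < K) prime (a + q * k) <= z.+1 +
    \sum_(0 <= k < K) (prime (a + q * k) && (z < a + q * k)))%N.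
  apply: (@leq_trans (\sum_(0 <= k < K) (k < z.+1) +
    \sum_(0 <= k < K) (prime (a + q * k) && (z < a + q * k)))%N).
    rewrite -big_split /=; apply: leq_sum => k _; case: (prime _) => //=.
    case: (ltnP z (a + q * k)) => h; first by rewrite leq_addl.
    by have -> : (k < z.+1)%N by nia.
  rewrite leq_add2r; apply: leq_trans (geq_minr K z.+1).
  elim: K => [|K IH]; first by rewrite big_geq.
  by rewrite big_nat_recr //=; case: ltnP => ? /=; lia.
have large : (\sum_(0 <= k < K) (prime (a + q * k) && (z < a + q * k)))%:R <=
    \sum_(0 <= k < K) sieve_sum (a + q * k) ^+ 2.
  rewrite natr_sum; apply: ler_sum => k _; case: andP => [[pk zk]|_].
    by rewrite sieve_sum_prime ?expr1n.
  exact: sqr_ge0.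
have expand : \sum_(0 <= k < K) sieve_sum (a + q * k) ^+ 2 =
    \sum_(A | sieve_dom A) \sum_(B | sieve_dom B) sieve_weight A * sieve_weight B *
      (\sum_(0 <= k < K) (setprod (A :|: B) %| a + q * k))%:R.
  under eq_bigr do rewrite expr2 big_distrlr /=.
  rewrite exchange_big /=; apply: eq_bigr => A dA.
  rewrite exchange_big /=; apply: eq_bigr => B dB.
  rewrite natr_sum mulr_sumr; apply: eq_bigr => k _.
  have [/andP[sA _] /andP[sB _]] := (dA, dB).
  by rewrite dvdn_setprodU // -mulnb natrM; ring.
(* Each count is replaced by K / V with an error of at most 1. *)
have main : \sum_(A | sieve_dom A) \sum_(B | sieve_dom B) sieve_weight A * sieve_weight B *
      (\sum_(0 <= k < K) (setprod (A :|: B) %| a + q * k))%:R <=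
   \sum_(A | sieve_dom A) \sum_(B | sieve_dom B)
     (K%:R * (sieve_weight A * sieve_weight B / (setprod (A :|: B))%:R) +
      `|sieve_weight A| * `|sieve_weight B|).
  apply: ler_sum => A dA; apply: ler_sum => B dB.
  have [/andP[sA _] /andP[sB _]] := (dA, dB).
  have sU := sievingU sA sB.
  have [] := sum_dvdn_progression a K (setprod_gt0 sU) (coprime_setprod sU).
  move: (\sum_(0 <= k < K) _)%N => c; set V := setprod _ => c1 c2.
  have V0 : 0 < V%:R :> R by rewrite ltr0n setprod_gt0.
  rewrite -normrM; move: (sieve_weight A * sieve_weight B) => w.
  have -> : w * c%:R = K%:R * (w / V%:R) + w * (c%:R - K%:R / V%:R) by field; rewrite gt_eqF.
  rewrite lerD2l (le_trans (ler_norm _)) // normrM ler_piMr // ler_norml.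
  have x1 : K%:R / V%:R <= c%:R + 1 :> R.
    by rewrite ler_pdivrMr // natr1 -natrM ler_nat.
  have x2 : c%:R - 1 <= K%:R / V%:R :> R.
    by rewrite ler_pdivlMr // mulrBl mul1r lerBlDr -natrM -natrD ler_nat.
  by apply/andP; split; lra.
have weights : \sum_(A | sieve_dom A) \sum_(B | sieve_dom B)
      `|sieve_weight A| * `|sieve_weight B| <= (z * z.+1)%:R ^+ 2.
  rewrite expr2 -big_distrlr /= -!expr2.
  have S0 : 0 <= \sum_(A | sieve_dom A) `|sieve_weight A| by apply: sumr_ge0.
  rewrite ler_sqr ?nnegrE //.
  apply: (@le_trans _ _ (\sum_(A | sieve_dom A) z%:R)).
    by apply: ler_sum => A; apply: norm_sieve_weight.
  rewrite sumr_const -[_ *+ _]mulr_natr -natrM ler_nat leq_mul2l.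
  by rewrite (leq_trans _ card_sieve_dom) ?orbT.
apply: (le_trans (_ : _ <= (z.+1 + _)%:R)); first by rewrite ler_nat; apply: small.
rewrite natrD -addrA lerD2l (le_trans large) // expand (le_trans main) //.
under eq_bigr do rewrite big_split /= -mulr_sumr.
rewrite big_split /= -mulr_sumr sieve_quadratic_form.
by rewrite lerD2l.
Qed.

(** * Comparison of the sieve mass with a harmonic sum *)

(** Strong induction, splitting off the least prime factor [p]: it joins [A] if absent, and
    otherwise leaves [A] and enters the square part. *)
Lemma squarefree_square_decomposition (n : nat) : (0 < n <= z)%N -> coprime n q ->
  exists A m, [/\ sieve_dom A, (0 < m <= z)%N & n = (setprod A * m ^ 2)%N].
Proof.
have [b] := ubnP n; elim: b n => // b IH n nb /andP[n0 nz] cn.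
have [n1|n1] := leqP n 1.
  exists finset.set0, 1%N; rewrite sieve_dom0 setprod0 z_gt0; split => //; lia.
pose p := pdiv n; have pp : prime p := pdiv_prime n1.
have /dvdnP[n' nE] : (p %| n)%N := pdiv_dvd n.
have p1 := prime_gt1 pp.
have n'0 : (0 < n')%N by nia.
have [cn' cp] : coprime n' q /\ coprime p q.
  by move: cn; rewrite nE coprimeMl => /andP[].
have [||//|A [m [dA /andP[m0 mz] n'E]]] := IH n'; [nia|nia|].
have pz : (p < z.+1)%N by nia.
pose i := Ordinal pz; have [sA vA] := andP dA.
have [iA|iA] := boolP (i \in A).
  exists (A :\ i), (p * m)%N.
  have e : (setprod A = p * setprod (A :\ i))%N by rewrite /setprod (big_setD1 i).
  have e0 : (0 < setprod A)%N := setprod_gt0 sA.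
  split; [apply: sieve_dom_sub dA; apply: finset.subD1set| |]; last by rewrite nE n'E e; ring.
  rewrite muln_gt0 (ltnW p1) m0 /= (leq_trans _ nz) // nE n'E e.
  rewrite (_ : (_ * p)%N = (p * m) * (setprod (A :\ i) * m * p))%N; last by ring.
  by rewrite leq_pmulr // !muln_gt0 m0 (ltnW p1) !andbT; lia.
exists (i |: A), m; have e : (setprod (i |: A) = p * setprod A)%N.
  by rewrite /setprod big_setU1.
have e0 : (0 < setprod A)%N := setprod_gt0 sA.
split; rewrite ?m0 ?mz //; last by rewrite nE n'E e; ring.
rewrite /sieve_dom; apply/andP; split; last by rewrite e; nia.
apply/forall_inP => j; rewrite !inE => /orP[/eqP ->|/(forall_inP sA)//].
by rewrite pp.
Qed.

Lemma sum_inv_sqr_le2 (n : nat) : \sum_(1 <= m < n.+1) ((m ^ 2)%:R : R)^-1 <= 2.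
Proof.
(* The stronger bound makes the induction telescope. At n = 0 the inverse is 0 by convention, so the
   step from 0 to 1 is done separately. *)
suff : \sum_(1 <= m < n.+1) ((m ^ 2)%:R : R)^-1 <= 2 - n%:R^-1.
  by move/le_trans; apply; rewrite lerBlDr lerDl invr_ge0 ler0n.
elim: n => [|n IH]; first by rewrite big_geq // invr0 subr0.
rewrite big_nat_recr //=; have [->|n0] := posnP n.
  by rewrite big_geq // exp1n invr1; lra.
apply: (le_trans (lerD IH (lexx _))).
have t0 : 0 < n%:R :> R by rewrite ltr0n.
have -> : ((n.+1 ^ 2)%:R : R) = (n%:R + 1) ^+ 2 by rewrite natrX -natr1.
rewrite -subr_ge0 -[n.+1%:R]natr1.
rewrite (_ : 2 - _ - _ = (n%:R * (n%:R + 1) ^+ 2)^-1); last first.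
  by field; rewrite !gt_eqF //; lra.
by rewrite invr_ge0 mulr_ge0 ?sqr_ge0.
Qed.

(** Writing n = d m^2 with d squarefree, the sum is at most that of 1/d times that of 1/m^2; the
    latter is at most 2, and 1/d <= 1/phi(d). *)
Lemma sieve_mass_coprime_sum :
  \sum_(1 <= n < z.+1 | coprime n q) (n%:R : R)^-1 <= 2 * sieve_mass.
Proof.
apply: (@le_trans _ _ (\sum_(1 <= n < z.+1) \sum_(A | sieve_dom A)
   \sum_(1 <= m < z.+1) (n == setprod A * m ^ 2)%N%:R / (setprod A * m ^ 2)%:R)).
  rewrite big_mkcond /= big_nat [leRHS]big_nat; apply: ler_sum => n nz.
  have pos (A : {set 'I_z.+1}) m :
      0 <= (n == setprod A * m ^ 2)%N%:R / (setprod A * m ^ 2)%:R :> R.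
    by rewrite divr_ge0 ?ler0n.
  case: ifP => cn; last by do 2!apply: sumr_ge0 => ? _.
  have [A [m [dA mz nE]]] := squarefree_square_decomposition nz cn.
  rewrite (bigD1 A) //= (bigD1_seq m) ?mem_index_iota ?iota_uniq //=.
  rewrite -nE eqxx mul1r -addrA lerDl addr_ge0 ?sumr_ge0 // => B _.
  by apply: sumr_ge0.
rewrite exchange_big /= mulr_sumr; apply: ler_sum => A dA.
have sA : sieving A by case/andP: dA.
apply: (@le_trans _ _ (\sum_(1 <= m < z.+1) ((setprod A)%:R^-1 * ((m ^ 2)%:R)^-1))).
  rewrite exchange_big /=; apply: ler_sum => m _; rewrite -mulr_suml natrM invfM.
  rewrite ler_piMl ?mulr_ge0 ?invr_ge0 ?ler0n //.
  set x := (_ * _)%N; case: (boolP (x \in index_iota 1 z.+1)) => [xi|xi].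
    rewrite (bigD1_seq x) ?iota_uniq //= eqxx big1 ?addr0 // => y yx.
    by rewrite (negbTE yx).
  rewrite big_seq big1 ?ler01 // => y yi; case: eqP => // e.
  by move: xi; rewrite -e yi.
have S0 : 0 <= \sum_(1 <= m < z.+1) ((m ^ 2)%:R : R)^-1.
  by apply: sumr_ge0 => m _; rewrite invr_ge0 ler0n.
rewrite -mulr_sumr [leRHS]mulrC ler_pM ?invr_ge0 ?ler0n //.
  rewrite lef_pV2 ?posrE ?ltr0n ?setprod_gt0 ?sphi_gt0 //.
  rewrite /setprod natr_prod /sphi; apply: ler_prod => i iA.
  by rewrite lerBlDr lerDl ler01 subr_ge0 ler1n ltnW // prime_gt1 // (sieving_prime sA).
exact: sum_inv_sqr_le2.
Qed.

End SelbergSieve.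

(** * Primes in an arithmetic progression *)

Section PrimesInProgressions.
Variable R : realFieldType.

Definition harmonic_sum (z : nat) : R := \sum_(1 <= n < z.+1) n%:R^-1.

Lemma harmonic_sum_ge0 (z : nat) : 0 <= harmonic_sum z.
Proof. by apply: sumr_ge0 => n _; rewrite invr_ge0 ler0n. Qed.

(** Each dyadic block from 2^t + 1 to 2^(t+1) contributes at least 1/2. *)
Lemma harmonic_sum_pow2 (t : nat) : t%:R / 2 <= harmonic_sum (2 ^ t).
Proof.
elim: t => [|t IH]; first by rewrite mul0r harmonic_sum_ge0.
rewrite /harmonic_sum (@big_cat_nat _ _ _ (2 ^ t).+1) //=; last first.
  by rewrite ltnS leq_exp2l.
rewrite -natr1 mulrDl lerD //.
apply: (@le_trans _ _ (\sum_((2 ^ t).+1 <= n < (2 ^ t.+1).+1) ((2 ^ t.+1)%:R)^-1)).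
  have P0 : (2 ^ t)%:R != 0 :> R by rewrite pnatr_eq0 -lt0n expn_gt0.
  have E : (2 ^ t.+1 = 2 * 2 ^ t)%N := expnS 2 t.
  rewrite sumr_const_nat (_ : (_ - _)%N = (2 ^ t)%N); last by lia.
  by rewrite -[leRHS]mulr_natr E natrM invfM -mulrA mulVf // mulr1 mul1r.
apply: ler_sum_nat => n /andP[n1 n2].
by rewrite lef_pV2 ?posrE ?ltr0n ?expn_gt0 ?ler_nat //; lia.
Qed.

Lemma harmonic_multiples (z p : nat) : (0 < p)%N ->
  \sum_(1 <= n < z.+1 | (p %| n)%N) n%:R^-1 <= p%:R^-1 * harmonic_sum z.
Proof.
move=> p0; apply: (@le_trans _ _ (\sum_(1 <= n < z.+1) \sum_(1 <= m < z.+1)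
   (n == p * m)%N%:R * (p%:R^-1 * m%:R^-1))).
  rewrite big_mkcond /= big_nat [leRHS]big_nat; apply: ler_sum => n /andP[n0 nz].
  have pos m : 0 <= (n == p * m)%N%:R * (p%:R^-1 * m%:R^-1) :> R.
    by rewrite !mulr_ge0 ?invr_ge0 ?ler0n.
  case: ifP => [/dvdnP[m nE]|_]; last by apply: sumr_ge0.
  rewrite (bigD1_seq m) ?mem_index_iota ?iota_uniq //=; last by nia.
  move: pos; rewrite nE (mulnC m p) => pos.
  by rewrite eqxx mul1r natrM invfM lerDl sumr_ge0.
rewrite exchange_big /= /harmonic_sum mulr_sumr; apply: ler_sum => m _.
rewrite -mulr_suml ler_piMl ?mulr_ge0 ?invr_ge0 ?ler0n //.
case: (boolP (p * m \in index_iota 1 z.+1)%N) => [xi|xi].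
  rewrite (bigD1_seq (p * m)%N) ?iota_uniq //= eqxx big1 ?addr0 // => y yx.
  by rewrite (negbTE yx).
rewrite big_seq big1 ?ler01 // => y yi; case: eqP => // e.
by move: xi; rewrite -e yi.
Qed.

(** A substitute for bounding q/phi(q). The list has only to cover the prime divisors, so lists for
    several factors may simply be concatenated. *)
Definition few_prime_divisors (q : nat) : Prop := exists s : seq nat,
  (forall p, prime p -> (p %| q)%N -> p \in s) /\
  \sum_(p <- s | (0 < p)%N) (p%:R : R)^-1 <= 2^-1.

(** Union bound: the multiples of the primes dividing [q] account for at most half of the harmonic
    sum. *)
Lemma harmonic_coprime (q z : nat) : few_prime_divisors q ->
  harmonic_sum z <= 2 * \sum_(1 <= n < z.+1 | coprime n q) n%:R^-1.
Proof.
case=> s [sq s2]; have H0 := harmonic_sum_ge0 z.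
have key : harmonic_sum z <= \sum_(1 <= n < z.+1 | coprime n q) n%:R^-1 +
    \sum_(p <- s | (0 < p)%N) p%:R^-1 * harmonic_sum z.
  apply: (@le_trans _ _ (\sum_(1 <= n < z.+1 | coprime n q) n%:R^-1 +
    \sum_(p <- s | (0 < p)%N) \sum_(1 <= n < z.+1 | (p %| n)%N) n%:R^-1)); last first.
    by rewrite lerD2l; apply: ler_sum => p p0; apply: harmonic_multiples.
  rewrite (exchange_big_dep predT) //= big_mkcond /= -big_split /=.
  apply: ler_sum_nat => n /andP[n0 nz].
  have pos : 0 <= n%:R^-1 :> R by rewrite invr_ge0 ler0n.
  case: (boolP (coprime n q)) => cn; first by rewrite lerDl sumr_ge0.
  rewrite add0r; have g1 : (1 < gcdn n q)%N.
    by rewrite ltn_neqAle eq_sym cn gcdn_gt0 n0.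
  have pp := pdiv_prime g1; have := pdiv_dvd (gcdn n q).
  rewrite dvdn_gcd => /andP[pn pq]; have := sq _ pp pq.
  move/(perm_to_rem) => /(perm_big _) ->; rewrite big_cons pn prime_gt0 //=.
  by rewrite lerDl sumr_ge0.
rewrite -mulr_suml in key.
have : (\sum_(p <- s | (0 < p)%N) p%:R^-1) * harmonic_sum z <= 2^-1 * harmonic_sum z.
  by rewrite ler_wpM2r.
by lra.
Qed.

(** The sieve at level z = 2^t; the two terms free of [K] together are at most 8 z^4 = 2^(4t+3). *)
Theorem count_primes_progression (q a K t : nat) : (0 < q)%N -> (0 < t)%N ->
  few_prime_divisors q ->
  (\sum_(0 <= k < K) prime (a + q * k))%:R <= 8 * K%:R / t%:R + (2 ^ (4 * t + 3))%:R :> R.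
Proof.
move=> q0 t0 fq; have z0 : (0 < 2 ^ t)%N by rewrite expn_gt0.
have L0 := sieve_mass_gt0 R q z0.
apply: (le_trans (Selberg_sieve_primes R z0 a K q0)).
(* A factor 2 is lost three times: on dyadic blocks, on coprimality to [q], and on square parts. *)
have massL : t%:R <= 8 * sieve_mass R q (2 ^ t).
  have h1 := harmonic_sum_pow2 t.
  have h2 := harmonic_coprime (2 ^ t) fq.
  have h3 := sieve_mass_coprime_sum R q z0.
  lra.
have tR : 0 < t%:R :> R by rewrite ltr0n.
rewrite addrAC addrC lerD //.
  rewrite ler_pdivrMr // mulrAC ler_pdivlMr // [leRHS]mulrAC mulrC.
  by rewrite ler_wpM2r ?ler0n.
rewrite -natrX -natrD ler_nat expnD mulnC expnM.
have -> : ((2 ^ 4) ^ t = (2 ^ t) ^ 4)%N by rewrite -!expnM mulnC.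
move: (2 ^ t)%N z0 => z z0.
have e1 : (z.+1 <= 2 * z)%N by lia.
have e2 : (z <= z ^ 4)%N by rewrite -{1}[z]expn1 leq_pexp2l.
have e3 : (z * z.+1 <= 2 * z ^ 2)%N by nia.
have e4 : (z ^ 4 = z ^ 2 * z ^ 2)%N by rewrite -expnD.
nia.
Qed.
End PrimesInProgressions.

Local Close Scope ring_scope.

(** * Elite primes and residues modulo Fermat numbers *)

Lemma odd_fermat (j : nat) : odd (fermat j).
Proof. by rewrite /fermat oddD oddX expn_eq0. Qed.

(** In other words F_j = 1 mod 4, which removes the sign from reciprocity. *)
Lemma fermat_half_even (j : nat) : 0 < j -> ~~ odd (fermat j)./2.
Proof.
case: j => // j _; rewrite /fermat addn1 expnS.
have e : 2 ^ 2 ^ j = 2 * 2 ^ (2 ^ j - 1) by rewrite -expnS subn1 prednK ?expn_gt0.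
rewrite mulnC expnM e; move: (2 ^ (2 ^ j - 1)) => x.
have -> : (2 * x) ^ 2 = (x ^ 2).*2.*2 by lia.
by rewrite (half_bit_double _ true) odd_double.
Qed.

Lemma fermat_gt0 (j : nat) : 0 < fermat j.
Proof. by rewrite /fermat addn1. Qed.

Definition fermat_prod (m n : nat) : nat := \prod_(m <= j < n) fermat j.

Lemma fermat_prod_gt0 (m n : nat) : 0 < fermat_prod m n.
Proof. by apply: prodn_gt0 => j; apply: fermat_gt0. Qed.

(** Telescoping by (y - 1)(y + 1) = y^2 - 1 with y = 2^(2^j). *)
Lemma fermat_prodE (m n : nat) : m <= n ->
  fermat_prod m n * (2 ^ 2 ^ m - 1) = 2 ^ 2 ^ n - 1.
Proof.
rewrite /fermat_prod; elim: n => [|n IH].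
  by rewrite leqn0 => /eqP ->; rewrite big_geq ?mul1n.
rewrite leq_eqVlt => /predU1P[->|mn]; first by rewrite big_geq ?mul1n.
rewrite big_nat_recr //= mulnAC IH // /fermat expnS [2 * _]mulnC expnM.
have := expn_gt0 2 (2 ^ n); move: (2 ^ 2 ^ n) => x; nia.
Qed.

Lemma fermat_prod_lt (m n : nat) : m <= n -> fermat_prod m n < 2 ^ 2 ^ n.
Proof.
move=> mn; have := fermat_prodE mn.
have : 1 < 2 ^ 2 ^ m by rewrite -{1}(expn0 2) ltn_exp2l ?expn_gt0.
have : 0 < 2 ^ 2 ^ n by rewrite expn_gt0.
move: (2 ^ 2 ^ m) (2 ^ 2 ^ n) (fermat_prod m n) => x y w; nia.
Qed.

(** A common divisor divides both 2^(2^n) - 1 and 2^(2^n) + 1, hence 2, while F_n is odd. *)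
Lemma coprime_fermat_prod (m n : nat) : m <= n ->
  coprime (fermat_prod m n) (fermat n).
Proof.
move=> mn; set g := gcdn (fermat_prod m n) (fermat n).
have gF : g %| fermat n := dvdn_gcdr _ _.
have gP : g %| 2 ^ 2 ^ n - 1.
  by rewrite -(fermat_prodE mn) dvdn_mulr // dvdn_gcdl.
have : g %| fermat n - (2 ^ 2 ^ n - 1) by apply: dvdn_sub.
have -> : fermat n - (2 ^ 2 ^ n - 1) = 2.
  by rewrite /fermat; have := expn_gt0 2 (2 ^ n); lia.
rewrite dvdn_divisors // !inE => /orP[//|/eqP g2].
by move: gF; rewrite g2 dvdn2 odd_fermat.
Qed.

Lemma modn_exp_odd (p x k : nat) : p %| x + 1 -> odd k -> x ^ k = x %[mod p].
Proof.
case: x => [|x] px ok; first by rewrite exp0n; case: k ok.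
have x2 : x.+1 ^ 2 = 1 %[mod p].
  apply/eqP; rewrite eqn_mod_dvd ?expn_gt0 //.
  have -> : x.+1 ^ 2 - 1 = x * (x.+1 + 1) by lia.
  by rewrite dvdn_mull.
rewrite -(odd_double_half k) ok expnS -mul2n expnM.
by rewrite -modnMmr -modnXm x2 modnXm exp1n modnMmr muln1.
Qed.

(** Let p - 1 = 2^e k with k odd. If e <= j, then (2^(2^j))^k is -1 modulo [p] as an odd power of
    -1, and 1 as a power of 2^(p-1); this forces p = 2. So e > j. *)
Lemma fermat_prime_divisor (p j : nat) : prime p -> p %| fermat j -> 2 ^ j.+1 < p.
Proof.
move=> pp pF; have p1 := prime_gt1 pp.
have p2 : p <> 2 by move=> p2; move: pF; rewrite p2 dvdn2 odd_fermat.
have [k k2 pE] : {k | coprime 2 k & p.-1 = k * 2 ^ logn 2 p.-1}.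
  by apply: pfactor_coprime => //; lia.
rewrite coprime2n in k2; have k0 : 0 < k by case: k k2 {pE}.
have [lj|lj] := ltnP j (logn 2 p.-1).
  have : 2 ^ j.+1 <= 2 ^ logn 2 p.-1 by rewrite leq_exp2l.
  by move: (2 ^ j.+1) (2 ^ _) pE; nia.
have e1 := modn_exp_odd pF k2.
have e2 : (2 ^ 2 ^ j) ^ k = 1 %[mod p].
  have -> : (2 ^ 2 ^ j) ^ k = (2 ^ p.-1) ^ (2 ^ (j - logn 2 p.-1)).
    rewrite -!expnM {1}pE; congr (2 ^ _).
    by rewrite -mulnA -expnD subnKC // mulnC.
  rewrite -modnXm -totient_prime // Euler_exp_totient ?modnXm ?exp1n //.
  by rewrite coprime2n; case: (even_prime pp).
have : p %| 2.
  have := esym e1; rewrite e2 => /eqP; rewrite eqn_mod_dvd ?expn_gt0 //.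
  move=> d; have -> : 2 = fermat j - (2 ^ 2 ^ j - 1).
    by rewrite /fermat; have := expn_gt0 2 (2 ^ j); lia.
  exact: dvdn_sub.
by rewrite dvdn_prime2 // => /eqP.
Qed.

(** The prime factors all exceed 2^(j+1), while their product is at most F_j < 2^(2^j + 1). *)
Lemma size_primes_fermat (j : nat) : size (primes (fermat j)) * j.+1 <= 2 ^ j.
Proof.
rewrite leqNgt; apply/negP => lt.
have : 2 ^ (size (primes (fermat j)) * j.+1) <= fermat j.
  rewrite mulnC expnM /primes size_map.
  rewrite [X in _ <= X](prod_prime_decomp (fermat_gt0 j)).
  have : forall f, f \in prime_decomp (fermat j) -> 2 ^ j.+1 <= f.1 ^ f.2.
    case=> p e /mem_prime_decomp[pp e0 pe] /=.
    apply: (@leq_trans (p ^ 1)); last by apply: leq_pexp2l => //; apply: prime_gt0.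
    rewrite expn1 ltnW // fermat_prime_divisor //.
    by apply: dvdn_trans pe; rewrite -{1}[p]expn1 dvdn_exp2l.
  elim: (prime_decomp _) => [|f s IH] fs; first by rewrite big_nil.
  rewrite big_cons /= expnS leq_mul ?fs ?mem_head // IH // => g gs.
  by apply: fs; rewrite inE gs orbT.
rewrite leqNgt => /negP; apply.
apply: (@leq_trans (2 ^ (2 ^ j).+1)); last by rewrite leq_exp2l.
rewrite expnS /fermat; have : 1 < 2 ^ 2 ^ j by rewrite -{1}(expn0 2) ltn_exp2l ?expn_gt0.
lia.
Qed.

Lemma few_prime_divisors_pow2 (R : realFieldType) (n : nat) :
  few_prime_divisors R (2 ^ n).
Proof.
exists [:: 2]; rewrite big_cons big_nil /= addr0; split=> // p pp.
by rewrite Euclid_dvdX // inE dvdn_prime2 // => /andP[].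
Qed.

Local Open Scope ring_scope.

(** F_j has at most 2^j/(j+1) prime divisors, each above 2^(j+1), so its reciprocals sum to at most
    1/(2n); there are [n] values of j. *)
Lemma few_prime_divisors_fermat (R : realFieldType) (n : nat) : (0 < n)%N ->
  few_prime_divisors R (fermat_prod n (n + n)).
Proof.
move=> n0; exists (flatten [seq primes (fermat j) | j <- index_iota n (n + n)]).
split=> [p pp|].
  rewrite /fermat_prod Euclid_dvd_prod // big_has_cond => /hasP[j jn /= pj].
  apply/flattenP; exists (primes (fermat j)); first by apply/mapP; exists j.
  by rewrite mem_primes pp fermat_gt0.
rewrite big_flatten big_map /=.
apply: (@le_trans _ _ (\sum_(n <= j < n + n) (2 * n%:R)^-1)).
  apply: ler_sum_nat => j /andP[nj _].
  apply: (@le_trans _ _ (\sum_(p <- primes (fermat j)) ((2 ^ j.+1)%:R : R)^-1)).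
    rewrite big_mkcond /= big_seq [leRHS]big_seq; apply: ler_sum => p.
    rewrite mem_primes => /and3P[pp _ pj]; rewrite prime_gt0 //=.
    rewrite lef_pV2 ?posrE ?ltr0n ?expn_gt0 ?(prime_gt0 pp) // ler_nat ltnW //.
    exact: fermat_prime_divisor.
  rewrite big_const_seq count_predT iter_addr_0 -[leLHS]mulr_natr.
  have P0 : 0 < (2 ^ j.+1)%:R :> R by rewrite ltr0n expn_gt0.
  have N0 : 0 < 2 * n%:R :> R by rewrite mulr_gt0 ?ltr0n.
  rewrite [leLHS]mulrC ler_pdivrMr // [leRHS]mulrC ler_pdivlMr // -!natrM ler_nat.
  have := size_primes_fermat j; rewrite expnS; move: (size _) (2 ^ j)%N => w x; nia.
rewrite sumr_const_nat addnK -[leLHS]mulr_natr invfM -mulrA mulVf ?mulr1 //.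
by rewrite pnatr_eq0 -lt0n.
Qed.

Local Close Scope ring_scope.

Lemma quadratic_nonresidue_modr (p a b : nat) : a = b %[mod p] ->
  quadratic_nonresidue p a -> quadratic_nonresidue p b.
Proof.
move=> ab [ca na]; split.
  by rewrite -coprime_modl -ab coprime_modl.
by case=> y yb; apply: na; exists y; rewrite ab.
Qed.

(* With [p - 1 = 2 ^ e * k], [k] odd, [2 ^ j] is periodic modulo [p - 1] for
   [j >= e], hence [fermat j] is periodic modulo [p] from [e] on. *)
Lemma elite_nonresidue (p n j : nat) : elite_prime p -> p != 1 %[mod 2 ^ n] ->
  n <= j -> quadratic_nonresidue p (fermat j).
Proof.
move=> [pp [N elN]] pn nj; have p1 := prime_gt1 pp.
have [p2|podd] := even_prime pp.
  (* Modulo 2 every Fermat number is the square of 1, so 2 is not elite. *)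
  by have [_ []] := elN N (leqnn N); exists 1; rewrite p2 !modn2 odd_fermat.
have [k k2 pE] : {k | coprime 2 k & p.-1 = k * 2 ^ logn 2 p.-1}.
  by apply: pfactor_coprime => //; lia.
have ej : logn 2 p.-1 < n.
  rewrite ltnNge; apply/negP => le; move/negP: pn; apply.
  rewrite eqn_mod_dvd ?(ltnW p1) // subn1 pE dvdn_mull // dvdn_exp2l //.
have T0 : 0 < totient k by rewrite totient_gt0; case: k k2 {pE}.
(* The shift is a multiple of the period [totient k] and, as [totient k] is positive, carries the
   index to at least [N]. *)
apply: (@quadratic_nonresidue_modr _ (fermat (j + N * totient k))); last by apply: elN; nia.
have [c cE] : exists c, 2 ^ (j + N * totient k) = 2 ^ j + p.-1 * c.
  have : p.-1 %| 2 ^ (j + N * totient k) - 2 ^ j.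
    rewrite pE expnD -{2}[2 ^ j]muln1 -mulnBr mulnC dvdn_mul //.
      by rewrite dvdn_exp2l //; lia.
    rewrite -eqn_mod_dvd ?expn_gt0 // mulnC expnM -modnXm.
    by rewrite Euler_exp_totient // modnXm exp1n.
  case/dvdnP => c cE; exists c.
  by rewrite [p.-1 * c]mulnC -cE subnKC // leq_exp2l // leq_addr.
rewrite /fermat cE expnD expnM; apply/eqP; rewrite eqn_modDr; apply/eqP.
rewrite -modnMmr -modnXm -totient_prime // Euler_exp_totient ?coprime2n //.
by rewrite modnXm exp1n modnMmr muln1.
Qed.

(** If [p] had sign +1 modulo F_j, reciprocity with F_j = 1 mod 4 would give F_j sign +1 modulo [p],
    and Gauss's lemma would make it a square. *)
Lemma elite_gauss_minus (p n j : nat) : 0 < n -> elite_prime p ->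
  p != 1 %[mod 2 ^ n] -> n <= j -> gauss_minus (fermat j) p.
Proof.
move=> n0 el pn nj; have [cF nF] := elite_nonresidue el pn nj.
have [pp _] := el; have [p2|podd] := even_prime pp.
  by case: nF; exists 1; rewrite p2 !modn2 odd_fermat.
rewrite /gauss_minus coprime_sym cF /=; apply/negPn/negP => sp.
have := gauss_sign_reciprocity (odd_fermat j) podd cF.
rewrite (negbTE sp) addbF oddM (negbTE (fermat_half_even (leq_trans n0 nj))) /=.
by move/(Gauss_lemma_sqr pp podd cF).
Qed.

(** * Density of the admissible residue classes *)

Lemma gauss_minus_modl (n r : nat) : gauss_minus n (r %% n) = gauss_minus n r.
Proof. by rewrite /gauss_minus coprime_modl gauss_sign_modl. Qed.

Lemma count_chinese (m n : nat) (P Q : pred nat) : 0 < m -> 0 < n -> coprime m n ->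
  (forall r, P (r %% m) = P r) -> (forall r, Q (r %% n) = Q r) ->
  count (predI P Q) (iota 0 (m * n)) <= count P (iota 0 m) * count Q (iota 0 n).
Proof.
move=> m0 n0 cmn Pm Qn; rewrite -!size_filter -(size_allpairs pair).
apply: (@leq_size_inj _ _ (fun r => (r %% m, r %% n))).
- by rewrite filter_uniq ?iota_uniq.
- move=> r s; rewrite !mem_filter !mem_iota !add0n => /andP[_ /= rn] /andP[_ /= sn] [e1 e2].
  have : r == s %[mod m * n] by rewrite chinese_remainder // e1 e2 !eqxx.
  by rewrite !modn_small // => /eqP.
move=> r; rewrite mem_filter => /andP[/andP[/= Pr Qr] _].
by apply: allpairs_f; rewrite mem_filter mem_iota /= ?Pm ?Qn ?Pr ?Qr ltn_pmod.
Qed.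

Definition fermat_minus (m n r : nat) : bool :=
  all (fun j => gauss_minus (fermat j) r) (index_iota m n).

Lemma fermat_minus_modl (m n r : nat) :
  fermat_minus m n (r %% fermat_prod m n) = fermat_minus m n r.
Proof.
apply: eq_in_all => j jn; rewrite -gauss_minus_modl -[RHS]gauss_minus_modl.
congr gauss_minus; apply: modn_dvdm.
by rewrite /fermat_prod (bigD1_seq j) ?iota_uniq //= dvdn_mulr.
Qed.

(** Each further factor is coprime to the previous ones and, by [count_gauss_minus], at least halves
    the proportion. *)
Lemma count_fermat_minus (m n : nat) : m <= n ->
  count (fermat_minus m n) (iota 0 (fermat_prod m n)) * 2 ^ (n - m) <= fermat_prod m n.
Proof.
elim: n => [|n IH].
  by rewrite leqn0 => /eqP ->; rewrite /fermat_prod big_geq.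
rewrite leq_eqVlt => /predU1P[->|mn].
  by rewrite /fermat_prod big_geq // subnn muln1 (leq_trans (count_size _ _)).
have E : fermat_prod m n.+1 = fermat_prod m n * fermat n.
  by rewrite /fermat_prod big_nat_recr.
have := count_chinese (fermat_prod_gt0 m n) (fermat_gt0 n) (@coprime_fermat_prod m n mn)
  (fermat_minus_modl m n) (gauss_minus_modl (fermat n)).
rewrite E (@eq_count _ (fermat_minus m n.+1) (predI (fermat_minus m n) (gauss_minus (fermat n)))).
  have := IH mn; have := count_gauss_minus (odd_fermat n).
  rewrite subSn // expnS.
  move: (count _ _) (count _ _) (count _ _) (2 ^ _) => a b c d; nia.
move=> r; rewrite /fermat_minus /index_iota subSn // -addn1 iotaD all_cat /= subnKC // andbT //.
Qed.

(** Write p = r + q k; the X/q + 1 full periods cover [0, X]. *)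
Lemma count_residue_classes (q X : nat) (P Q : pred nat) : 0 < q ->
  (forall r, P (r %% q) = P r) ->
  count (fun p => Q p && P p) (iota 0 X.+1) <=
  \sum_(0 <= r < q | P r) \sum_(0 <= k < (X %/ q).+1) Q (r + q * k).
Proof.
move=> q0 Pq; rewrite -sum1_count big_mkcond /=.
have XK : X.+1 <= (X %/ q).+1 * q by rewrite ltn_ceil.
apply: (@leq_trans (\sum_(0 <= p < (X %/ q).+1 * q) (Q p && P p))).
  rewrite [X in _ <= X](@big_cat_nat _ _ _ X.+1) //=.
  apply: leq_trans (leq_addr _ _); rewrite /index_iota subn0.
  by apply: leq_sum => p _; case: ifP.
rewrite big_nat_mul exchange_big /= leq_sum // => k _.
rewrite mulSn -{1}[k * q]add0n big_addn addnK [X in _ <= X]big_mkcond leq_sum // => r _.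
have -> : P (r + k * q) = P r by rewrite -Pq addnC modnMDl Pq.
by rewrite [k * q]mulnC; case: (P r); rewrite ?andbT ?andbF.
Qed.

(** * Counting primes in a sparse union of classes *)

Local Open Scope ring_scope.

(** The sieve is applied with t = 4^n to at most q/2^n classes. As q K <= 2 X, the main terms give
    16 X/8^n; the error terms give at most X/8^n, because [q] and [t] are at most 2^t and X >= 2^(16
    t). *)
Lemma count_primes_classes (R : realFieldType) (q n X : nat) (P : pred nat) :
  few_prime_divisors R q -> (forall r : nat, P (r %% q)%N = P r) ->
  (0 < q <= 2 ^ 4 ^ n)%N -> (2 ^ (16 * 4 ^ n) <= X)%N ->
  (count P (iota 0 q) * 2 ^ n <= q)%N ->
  (count (fun p => prime p && P p) (iota 0 X.+1))%:R <= 17 * X%:R / (8 ^ n)%:R :> R.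
Proof.
move=> fq Pq /andP[q0 qB] BX cq; set t := (4 ^ n)%N in qB BX.
have t0 : (0 < t)%N by rewrite expn_gt0.
set K := (X %/ q).+1; set c := count P (iota 0 q) in cq.
have := count_residue_classes X prime q0 Pq.
rewrite -(ler_nat R) => /le_trans; apply.
apply: (@le_trans _ _ (c%:R * (8 * K%:R / t%:R + (2 ^ (4 * t + 3))%:R))).
  rewrite natr_sum; apply: (@le_trans _ _
    (\sum_(0 <= r < q | P r) (8 * K%:R / t%:R + (2 ^ (4 * t + 3))%:R))).
    by apply: ler_sum => r _; apply: count_primes_progression.
  by rewrite big_const_seq iter_addr_0 /index_iota subn0 [leRHS]mulr_natl.
have tE : t = (2 ^ n * 2 ^ n)%N by rewrite -expnMn.
have nE : (8 ^ n = 2 ^ n * t)%N by rewrite tE -!expnMn.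
have D0 : 0 < (2 ^ n)%:R :> R by rewrite ltr0n expn_gt0.
have tR : 0 < t%:R :> R by rewrite ltr0n.
rewrite ler_pdivlMr ?ltr0n ?expn_gt0 // nE natrM.
have -> : c%:R * (8 * K%:R / t%:R + (2 ^ (4 * t + 3))%:R) * ((2 ^ n)%:R * t%:R) =
  (8 * (c * 2 ^ n * K) + c * 2 ^ n * t * 2 ^ (4 * t + 3))%:R :> R.
  by rewrite !natrD !natrM; field; rewrite gt_eqF.
rewrite -natrM ler_nat.
have Bq : (2 ^ t <= 2 ^ (16 * t))%N by rewrite leq_exp2l //; lia.
have m1 : (c * 2 ^ n * K <= 2 * X)%N.
  apply: (@leq_trans (q * K)); first by rewrite leq_mul2r cq orbT.
  by rewrite /K mulnC mulSn; have := leq_trunc_div X q; lia.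
have m2 : (c * 2 ^ n * t * 2 ^ (4 * t + 3) <= X)%N.
  apply: leq_trans BX; apply: (@leq_trans (2 ^ t * 2 ^ t * 2 ^ (4 * t + 3))).
    rewrite leq_mul2r; apply/orP; right; apply: leq_mul; first exact: leq_trans cq qB.
    by rewrite ltnW // ltn_expl.
  by rewrite -!expnD leq_exp2l //; lia.
lia.
Qed.

(** Twice the constant 17: once for primes 1 modulo 2^n, once for those of sign -1 modulo F_n, ...,
    F_(2n-1). *)
Lemma elite_count_bound (R : realType) (x : R) (n : nat) : (0 < n)%N ->
  (2 ^ (16 * 4 ^ n))%:R <= x ->
  (elite_count x)%:R <= 34 * x / (8 ^ n)%:R.
Proof.
move=> n0 nx; rewrite /elite_count; set X := Num.truncn x.
have x0 : 0 <= x by apply: le_trans nx.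
have nX : (2 ^ (16 * 4 ^ n) <= X)%N by rewrite truncn_ge_nat.
have Xx : X%:R <= x by rewrite truncn_le.
pose P (r : nat) := (r == 1 %[mod 2 ^ n])%N; pose Q := fermat_minus n (n + n).
have split : (count (fun p => `[< elite_prime p >]) (iota 0 X.+1) <=
    count (fun p => prime p && P p) (iota 0 X.+1) +
    count (fun p => prime p && Q p) (iota 0 X.+1))%N.
  rewrite -count_predUI (leq_trans _ (leq_addr _ _)) //.
  apply: sub_count => p /asboolP el /=; have [pp _] := el; rewrite pp /=.
  case: (boolP (P p)) => //= Pp; apply/allP => j; rewrite mem_index_iota => /andP[nj _].
  exact: elite_gauss_minus el Pp nj.
have cP : (count (fun p => prime p && P p) (iota 0 X.+1))%:R <= 17 * X%:R / (8 ^ n)%:R :> R.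
  apply: (@count_primes_classes R (2 ^ n)) => //.
  - exact: few_prime_divisors_pow2.
  - by move=> r; rewrite /P modn_mod.
  - by rewrite expn_gt0 leq_exp2l //= ltnW // ltn_expl.
  rewrite -[Y in (_ <= Y)%N]mul1n leq_mul2r; apply/orP; right.
  rewrite -size_filter -[Y in (_ <= Y)%N]/(size [:: 1%N]).
  apply: (@leq_size_inj _ _ id) => [||r]; rewrite ?filter_uniq ?iota_uniq //.
  rewrite mem_filter mem_iota add0n => /andP[/= /eqP r1 rn].
  rewrite inE -(modn_small rn) r1 modn_small // -{1}(expn0 2) ltn_exp2l //.
have cQ : (count (fun p => prime p && Q p) (iota 0 X.+1))%:R <= 17 * X%:R / (8 ^ n)%:R :> R.
  apply: (@count_primes_classes R (fermat_prod n (n + n))) => //.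
  - exact: few_prime_divisors_fermat.
  - by move=> r; apply: fermat_minus_modl.
  - rewrite fermat_prod_gt0 /= ltnW // (leq_trans (fermat_prod_lt (leq_addr n n))) //.
    by rewrite addnn -mul2n expnM.
  have := count_fermat_minus (leq_addr n n); by rewrite addnK.
apply: (@le_trans _ _ (34 * X%:R / (8 ^ n)%:R)); last first.
  by rewrite ler_wpM2r ?invr_ge0 ?ler0n // ler_wpM2l.
rewrite -(ler_nat R) natrD in split.
move: cP cQ; rewrite -!mulrA; move: (X%:R / _) => u; lra.
Qed.

(** * Choice of the parameter and the asymptotic bound *)

Theorem theorem1 (R : realType) :
  (fun x : R => (elite_count x)%:R : R^o) =O_ (+oo_R)
  (fun x : R => x / (ln x `^ (3 / 2)) : R^o).
Proof.
(* The factor 512 = 8^3 arises from ln x <= (8 * 2^n)^2, which gives (ln x)^(3/2) <= 512 * 8^n. *)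
apply/eqO_exP; exists (34 * 512) => //.
near=> x.
have x64 : (2 ^ 64)%:R <= x by near: x; apply: nbhs_pinfty_ge; rewrite num_real.
have x0 : 0 < x by apply: lt_le_trans x64; rewrite ltr0n expn_gt0.
(* The largest [n] meeting the lower bound: x >= 2^64 admits n = 1, and failure at n + 1 is the
   upper bound, as 16 * 4^(n+1) = 64 * 4^n. *)
have [n [n0 nx xn]] : exists n, [/\ (0 < n)%N, (2 ^ (16 * 4 ^ n))%:R <= x &
    x < (2 ^ (64 * 4 ^ n))%:R].
  pose X := Num.truncn x.
  have ex1 : exists n, (2 ^ (16 * 4 ^ n) <= X)%N by exists 1%N; rewrite truncn_ge_nat ?(ltW x0).
  have bnd n : (2 ^ (16 * 4 ^ n) <= X)%N -> (n <= X)%N.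
    apply: leq_trans; apply: (leq_trans (ltnW (ltn_expl n (isT : 1 < 4)%N))).
    by apply: (leq_trans (ltnW (ltn_expl _ (isT : 1 < 2)%N))); rewrite leq_exp2l //; lia.
  case: (ex_maxnP ex1 bnd) => n nX nmax; exists n; split.
  - by apply: nmax; rewrite truncn_ge_nat ?(ltW x0).
  - by rewrite -truncn_ge_nat ?(ltW x0).
  rewrite -truncn_lt_nat ?(ltW x0) // ltnNge; apply/negP.
  have -> : (64 * 4 ^ n = 16 * 4 ^ n.+1)%N by rewrite expnS; lia.
  by move/nmax; rewrite ltnn.
have l0 : 0 < ln x.
  by rewrite ln_gt0 // (lt_le_trans _ x64) // ltr1n -{1}(expn0 2) ltn_exp2l.
have lx : ln x <= ((8 * 2 ^ n) ^ 2)%:R.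
  have -> : ((8 * 2 ^ n) ^ 2 = 64 * 4 ^ n)%N.
    by rewrite expnMn -expnM [(n * 2)%N]mulnC expnM.
  have l2 : ln 2 <= 1 :> R by have := @le_ln1Dx R 1; rewrite -[1 + 1]/(2%:R) => ->//; lra.
  apply: (@le_trans _ _ (ln (2 ^ (64 * 4 ^ n))%:R)).
    by rewrite ler_ln ?posrE ?ltr0n ?expn_gt0 // ltW.
  by rewrite natrX lnXn // -[leLHS]mulr_natl ler_piMr.
have px : ln x `^ (3 / 2) <= (512 * 8 ^ n)%:R.
  apply: le_trans (ge0_ler_powR _ _ _ lx) _; rewrite ?nnegrE ?(ltW l0) //.
  rewrite natrX -powR_mulrn // -powRrM mulrC divfK // powR_mulrn // -natrX ler_nat.
  by rewrite expnMn -expnM [(n * 3)%N]mulnC expnM.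
have p0 : 0 < ln x `^ (3 / 2) by rewrite powR_gt0.
rewrite ger0_norm // ger0_norm; last by rewrite divr_ge0 ?powR_ge0 // ltW.
apply: (le_trans (elite_count_bound n0 nx)).
have e0 : 0 < (8 ^ n)%:R :> R by rewrite ltr0n expn_gt0.
rewrite mulrA ler_pdivrMr // mulrAC ler_pdivlMr //.
rewrite natrM in px.
nra.
Unshelve. all: by end_near.
Qed.
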